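(* Let $G$ be a $k$-list-critical graph. Let $\mathcal{L}$ be the subgraph of $G$ induced on the vertices of degree $k-1$ in $G$ and let $\mathcal{H}$ be the subgraph of $G$ induced on the vertices of degree at least $k$ in $G$. If $\lambda$ is a real number with $2 \le \lambda \le \frac{6(k-1)}{k}$, then \[\beta(\mathcal{L}) \le \frac{2}{\lambda}\|\mathcal{H}\| + \frac{2\|G\| - (k-2)|G| - \left(\frac{k}{2} + \frac{k-1}{\lambda}\right)|\mathcal{H}| - 1}{k-1}.\]
   Context: All graphs are finite and simple. A graph is $m$-choosable if for every assignment of a list of at least $m$ colors to each vertex there is a proper coloring in which each vertex receives a color from its list. A graph $G$ is $k$-list-critical if $G$ is not $(k-1)$-choosable, but every proper subgraph of $G$ is $(k-1)$-choosable. For a graph $X$, $|X|$ is its number of vertices and $\|X\|$ its number of edges. $\beta(\mathcal{L})$ is the independence number of the subgraph of $\mathcal{L}$ induced on the vertices having degree $k-1$ in $\mathcal{L}$. *)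

(* Defs.v *)
From HB Require Import structures.
From mathcomp Require Import all_boot all_order all_algebra.
From mathcomp Require Import finmap reals.

Set Implicit Arguments.
Unset Strict Implicit.
Unset Printing Implicit Defensive.

(* A finite simple graph is carried by a set of vertices of an ambient finType,
   so that a graph and its subgraphs are objects of the same type. *)
Record sgraph (T : finType) := SGraph {
  vset : {set T};
  adj : rel T;
  adj_sym : symmetric adj;
  adj_irr : irreflexive adj;
  adj_vset : forall x y, adj x y -> x \in vset
}.

Section Graphs.
Variable T : finType.
Implicit Types (G H : sgraph T) (A : {set T}).

Definition nverts G : nat := #|vset G|.

Definition edges G : {set {set T}} :=
  [set [set x; y] | x in vset G, y in vset G & adj G x y].

Definition nedges G : nat := #|edges G|.

Definition deg G (v : T) : nat := #|[set u | adj G v u]|.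

Definition subgraph H G : Prop :=
  vset H \subset vset G /\ (forall x y, adj H x y -> adj G x y).

Definition proper_subgraph H G : Prop := subgraph H G /\ ~ subgraph G H.

Definition induced_adj G A : rel T :=
  fun x y => [&& x \in A, y \in A & adj G x y].

Lemma induced_sym G A : symmetric (induced_adj G A).
Proof. by move=> x y; rewrite /induced_adj (adj_sym G) andbCA. Qed.

Lemma induced_irr G A : irreflexive (induced_adj G A).
Proof. by move=> x; rewrite /induced_adj (adj_irr G) !andbF. Qed.

Lemma induced_vset G A x y : induced_adj G A x y -> x \in vset G :&: A.
Proof. by case/and3P=> xA _ /(adj_vset (s:=G)) xG; rewrite inE xG xA. Qed.

Definition induced G A : sgraph T :=
  SGraph (@induced_sym G A) (@induced_irr G A) (@induced_vset G A).

Definition independent G A : bool :=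
  (A \subset vset G) && [forall x in A, forall y in A, ~~ adj G x y].

Definition indep_number G : nat := \max_(A : {set T} | independent G A) #|A|.

(* Colors are natural numbers: only finitely many colors occur in the lists of
   a finite graph.  The values of L and c outside vset G are irrelevant; a
   fixed nonempty color type ensures that c exists when vset G is empty. *)
Definition choosable (m : nat) G : Prop :=
  forall L : T -> {fset nat},
    (forall v, v \in vset G -> m <= #|` L v|) ->
    exists c : T -> nat,
      (forall v, v \in vset G -> c v \in L v) /\
      (forall x y, adj G x y -> c x != c y).

Definition list_critical (k : nat) G : Prop :=
  ~ choosable (k - 1) G /\
  (forall H, proper_subgraph H G -> choosable (k - 1) H).

Definition low_subgraph (k : nat) G : sgraph T :=
  induced G [set v in vset G | deg G v == k - 1].

Definition high_subgraph (k : nat) G : sgraph T :=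
  induced G [set v in vset G | k <= deg G v].

(* Degrees are taken in L itself, not in a graph containing L. *)
Definition beta (k : nat) (L : sgraph T) : nat :=
  indep_number (induced L [set v in vset L | deg L v == k - 1]).

End Graphs.

(* Main.v *)
(* If A is independent in a k-list-critical graph G, then
   sum_{v in A} deg v + (k - 2)|G| + 1 <= 2||G|| (Kierstead and Rabern).  Indeed,
   bidirect the edges outside A and orient those at A: every such digraph is
   kernel-perfect, so some list colouring exists as soon as all out-degrees are
   at most k - 2; if the inequality fails, an orientation of least excess
   achieves this on a nonempty set of vertices, after colouring the others
   by criticality.

   Take A to be a maximum independent set of vertices counted by beta, which
   have no neighbour of degree at least k, together with an independent subset I
   of H.  With t = (k - 1) / lambda, which lies between k/6 and k/2, one can
   choose I so that k|I| >= (k/2 + t)|H| - 2t||H||. *)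
Require Import Defs.
From mathcomp Require Import all_boot all_order all_algebra.
From mathcomp Require Import finmap reals.
From mathcomp Require Import zify ring lra.
Import Order.TTheory GRing.Theory Num.Theory.
Local Open Scope ring_scope.

Set Implicit Arguments.
Unset Strict Implicit.

Definition outdeg (T : finType) (d : rel T) (x : T) : nat := #|[set y | d x y]|.

(** * Kernels of digraphs and list colouring *)

Section Kernels.
Local Open Scope nat_scope.
Variables (T : finType) (D : rel T).
Hypothesis D_irr : irreflexive D.

Definition kernel (S K : {set T}) : Prop :=
  [/\ K \subset S, {in K &, forall x y, ~~ D x y}
    & {in S :\: K, forall x, exists2 y, y \in K & D x y}].

(** If every vertex of [S :\: A] has an out-neighbour in [S :&: A], that intersection is a kernel.
    Otherwise some [b] outside [A] has none: delete [b] and its in-neighbours, and add [b] to a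
    kernel of the rest. No arc leads from [b] to that kernel: into [A] by the choice of [b],
    elsewhere by symmetry. *)
Lemma kernel_exists (A S : {set T}) :
  {in A &, forall x y, ~~ D x y} ->
  {in ~: A &, forall x y, D x y = D y x} ->
  exists K, kernel S K.
Proof.
move=> indA symB; have [n] := ubnP #|S|.
elim: n S => // n IHn S leSn.
case: (boolP [forall x in S :\: A, [exists y in S :&: A, D x y]]) => [allA|].
  exists (S :&: A); split; first exact: subsetIl.
    by move=> x y /setIP[_ xA] /setIP[_ yA]; apply: indA.
  move=> x; rewrite setDIr setDv set0U => xSA.
  by have /exists_inP[y yS Dxy] := forall_inP allA x xSA; exists y.
rewrite negb_forall_in => /exists_inP[b /setDP[bS bA]].
rewrite negb_exists_in => /forall_inP nob.
pose S' := [set x in S | (x != b) && ~~ D x b].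
have ltS : #|S'| < n.
  rewrite -ltnS (leq_trans _ leSn) // ltnS; apply: proper_card.
  apply/properP; split; first by apply/subsetP => x; rewrite inE => /andP[].
  by exists b => //; rewrite inE eqxx andbF.
have [K [KS' indK domK]] := IHn _ ltS.
have K_b x : x \in K -> [/\ x \in S, ~~ D x b & ~~ D b x].
  move/(subsetP KS'); rewrite inE => /and3P[xS _ nDxb]; split=> //.
  case: (boolP (x \in A)) => xA; first by apply: nob; rewrite inE xS.
  by rewrite symB ?inE.
exists (b |: K); split.
- by apply/subsetP => x /setU1P[-> //|/K_b[]].
- move=> x y /setU1P[->|xK] /setU1P[->|yK]; rewrite ?D_irr //.
  + by case: (K_b y yK).
  + by case: (K_b x xK).
  + exact: indK.
- move=> x /setDP[xS]; rewrite in_setU1 negb_or => /andP[xb xK].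
  case: (boolP (D x b)) => Dxb; first by exists b; rewrite ?setU11.
  have [|y yK Dxy] := domK x; first by rewrite !inE xK xS xb.
  by exists y; rewrite // setU1r.
Qed.

(* Bondy, Boppana and Siegel: a colour is spent on a kernel of the set of
   vertices whose list contains it. *)
Lemma kernel_perfect_coloring (F : {set T}) (L : T -> {fset nat}) :
  (forall S, exists K, kernel S K) ->
  {in F, forall v, #|[set y in F | D v y]| < #|` L v|} ->
  exists c : T -> nat,
    {in F, forall v, c v \in L v} /\
    {in F &, forall x y, D x y -> c x != c y}.
Proof.
move=> kerP; have [n] := ubnP #|F|.
elim: n F L => // n IHn F L leFn ltL.
have [->|[v vF]] := set_0Vmem F.
  by exists (fun=> 0); split=> x; rewrite inE.
have [col colv] : exists col, col \in L v.
  by apply/fset0Pn; rewrite -cardfs_gt0 (leq_trans _ (ltL v vF)).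
pose S := [set x in F | col \in L x].
have [K [KS indK domK]] := kerP S.
have KF : K \subset F.
  by apply/subsetP => x /(subsetP KS); rewrite inE => /andP[].
(* A nonempty kernel makes the uncoloured set shrink. *)
have [w wK] : exists w, w \in K.
  case: (boolP (v \in K)) => vK; first by exists v.
  have [|y yK _] := domK v; last by exists y.
  by rewrite !inE vK vF.
pose L' x := (L x `\ col)%fset.
have [||c [cL' c_proper]] := IHn (F :\: K) L'.
- rewrite -ltnS (leq_trans _ leFn) // ltnS; apply: proper_card.
  apply/properP; split; first exact: subsetDl.
  by exists w; rewrite ?(subsetP KF) // inE wK.
- move=> x xFK; have /setDP[xF xK] := xFK.
  have := ltL x xF; rewrite /L' (cardfsD1 col (L x)).
  have sub : [set y in F :\: K | D x y] \subset [set y in F | D x y].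
    by apply/subsetP => y; rewrite !inE => /andP[/andP[_ ->] ->].
  case: (boolP (col \in L x)) => colx; last first.
    by rewrite add0n; apply: leq_trans; rewrite ltnS subset_leq_card.
  (* A vertex that loses [col] from its list also loses an out-neighbour, namely one in [K]. *)
  rewrite add1n ltnS; apply: leq_trans.
  have [|y yK Dxy] := domK x; first by rewrite !inE xK xF.
  apply: proper_card; apply/properP; split=> //.
  by exists y; rewrite !inE ?yK ?(subsetP KF y yK) ?Dxy.
exists (fun x => if x \in K then col else c x); split.
  move=> x xF /=; case: ifPn => xK.
    by have := subsetP KS x xK; rewrite inE => /andP[].
  by have := cL' x; rewrite !inE xK xF => /(_ isT) /andP[].
have c_col z : z \in F -> z \notin K -> c z != col.
  by move=> zF zK; have := cL' z; rewrite !inE zK zF => /(_ isT) /andP[].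
move=> x y xF yF Dxy /=; case: ifPn => xK; case: ifPn => yK.
- by have := indK x y xK yK; rewrite Dxy.
- by rewrite eq_sym c_col.
- by rewrite c_col.
- by apply: c_proper; rewrite // inE ?xK ?yK.
Qed.

End Kernels.

(** * Orientations of least excess *)

Section Orientations.
Local Open Scope nat_scope.
Variables (T : finType) (e : rel T) (h : T -> nat) (c : nat).
Hypotheses (e_sym : symmetric e) (e_irr : irreflexive e).
Implicit Types (d : rel T) (u v w x y : T).

(** Booleans are added as naturals, so each edge receives exactly one direction and a non-edge
    none. *)
Definition orientation d : Prop := forall x y, d x y + d y x = e x y.

(** [h] will be the out-degree contributed by the bidirected edges, which no reorientation
    changes. *)
Definition load d x : nat := outdeg d x + h x.

Definition excess d : nat := \sum_x (load d x - c).

Definition flip u v d : rel T := fun x y =>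
  if (x == u) && (y == v) then false
  else if (x == v) && (y == u) then true else d x y.

Lemma orientation_exists : exists d, orientation d.
Proof.
exists (fun x y => e x y && (enum_rank x < enum_rank y)) => x y.
rewrite (e_sym y x); case: ltngtP => [_|_|/ord_inj/enum_rank_inj->];
  by rewrite ?e_irr ?andbF ?andbT ?addn0.
Qed.

Lemma orientation_arc d u v : orientation d -> d u v -> ~~ d v u /\ u != v.
Proof.
move=> od duv; have := od u v; rewrite duv.
case: eqVneq => [<-|_]; first by rewrite e_irr.
by case: (d v u); case: (e u v).
Qed.

Lemma flip_orientation d u v :
  orientation d -> d u v -> orientation (flip u v d).
Proof.
move=> od duv; have [/negbTE ndvu neq] := orientation_arc od duv.
have neq' : (v == u) = false by rewrite eq_sym (negbTE neq).
move=> x y; rewrite -od /flip.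
case: (eqVneq x u) => [->|xu]; case: (eqVneq y v) => [->|yv] /=;
  rewrite ?eqxx ?(negbTE neq) ?neq' ?duv ?ndvu ?andbF //=.
case: (eqVneq x v) => [->|xv]; case: (eqVneq y u) => [->|yu] /=;
  by rewrite ?eqxx ?duv ?ndvu ?andbF.
Qed.

Lemma load_flip d u v x : orientation d -> d u v ->
  load (flip u v d) x + (x == u) = load d x + (x == v).
Proof.
move=> od duv; have [/negbTE ndvu neq] := orientation_arc od duv.
suff: outdeg (flip u v d) x + (x == u) = outdeg d x + (x == v).
  by rewrite /load; lia.
rewrite /outdeg; case: (eqVneq x u) => [->|xu].
  rewrite (negbTE neq) addn0 (cardsD1 v [set y | d u y]) inE duv addnC.
  congr (_ + #|pred_of_set _|); apply/setP => y.
  by rewrite !inE /flip eqxx (negbTE neq) /=; case: eqVneq.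
case: (eqVneq x v) => [->|xv]; last first.
  by rewrite !addn0; apply: eq_card => y; rewrite !inE /flip (negbTE xu) (negbTE xv).
have neq' : (v == u) = false by rewrite eq_sym (negbTE neq).
rewrite addn0 (cardsD1 u) inE /flip !eqxx /= neq' /= addnC.
congr (_ + 1); apply: eq_card => y; rewrite !inE ?neq' ?eqxx /=.
by case: eqVneq => [->|] //=; rewrite ndvu.
Qed.

(* Reversing the first arc of a path moves one unit of excess along the path. *)
Lemma excess_reduce d u p :
  orientation d -> path d u p -> uniq (u :: p) ->
  c < load d u -> load d (last u p) < c ->
  exists2 d', orientation d' & excess d' < excess d.
Proof.
elim: p d u => [|v p IHp] d u od /=; first by lia.
case/andP=> duv dp /andP[uvp uniq_vp] ovu undl.
have [_ neq] := orientation_arc od duv.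
have ld x := load_flip x od duv.
have odf := flip_orientation od duv.
have exF d1 : excess d1 = (load d1 u - c) + ((load d1 v - c)
     + \sum_(x | (x != u) && (x != v)) (load d1 x - c)).
  by rewrite /excess (bigD1 u) // (bigD1 v) //= eq_sym.
have rest : \sum_(x | (x != u) && (x != v)) (load (flip u v d) x - c)
          = \sum_(x | (x != u) && (x != v)) (load d x - c).
  apply: eq_bigr => x /andP[/negbTE xu /negbTE xv].
  by have := ld x; rewrite xu xv !addn0 => ->.
have := ld u; have := ld v.
rewrite !eqxx (negbTE neq) eq_sym (negbTE neq) !addn0 => lv lu.
(* If [v] has room, it absorbs the unit and the excess drops. Otherwise the excess is unchanged and
   [v] is now overloaded, so the argument continues from [v]. *)
case: (ltnP (load d v) c) => ovv.
  by exists (flip u v d); rewrite // !exF rest; lia.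
have exE : excess (flip u v d) = excess d by rewrite !exF rest; lia.
rewrite -exE; apply: (IHp _ v) => //; last 2 first.
- lia.
- set w := last v p in undl *.
  have wv : w != v by apply: contraTneq undl => ->; rewrite -leqNgt.
  have wu : w != u by apply: contraNneq uvp => <-; apply: mem_last.
  by have := ld w; rewrite (negbTE wu) (negbTE wv) !addn0 => ->.
(* The rest of the path avoids [u], so the flip leaves its arcs alone. *)
have allu : all (fun x => x != u) (v :: p).
  by apply/allP => x xp; apply: contraNneq uvp => <-.
apply: sub_in_path allu dp => x y /negbTE xu /negbTE yu.
by rewrite /flip xu yu andbF.
Qed.

(* For an orientation of least excess, take [R] to be the set of vertices
   reachable from the overloaded ones. *)
Lemma orientation_closed_set :
  exists d (R : {set T}),
    [/\ orientation d,
        forall x y, x \in R -> d x y -> y \in R,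
        forall x, x \notin R -> load d x <= c,
        forall x, x \in R -> c <= load d x
      & R != set0 -> exists2 x, x \in R & c < load d x].
Proof.
have [d0 od0] := orientation_exists.
have [n] := ubnP (excess d0); elim: n d0 od0 => // n IHn d od led.
(* Either an overloaded vertex reaches one with spare room and the excess can be lowered, or every
   vertex reachable from an overloaded one has load at least [c]. *)
case: (boolP [exists u, exists w, [&& c < load d u, load d w < c & connect d u w]]).
  case/existsP => u /existsP[w /and3P[ovu undw /connectP[p dp w_last]]].
  move: undw; rewrite w_last; case/shortenP: dp => p' dp' up' _ undw.
  have [d' od' ltd] := excess_reduce od dp' up' ovu undw.
  by apply: (IHn d' od'); lia.
rewrite negb_exists => /forallP no.
exists d, [set w | [exists u, (c < load d u) && connect d u w]]; split=> //.
- move=> x y; rewrite !inE => /existsP[u /andP[ovu ux]] dxy.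
  by apply/existsP; exists u; rewrite ovu (connect_trans ux) ?connect1.
- move=> x; rewrite inE negb_exists => /forallP /(_ x).
  by rewrite connect0 andbT -leqNgt.
- move=> x; rewrite inE => /existsP[u /andP[ovu ux]].
  have := no u; rewrite negb_exists => /forallP /(_ x).
  by rewrite ovu ux andbT -leqNgt.
- case/set0Pn => x; rewrite inE => /existsP[u /andP[ovu _]].
  by exists u; rewrite // inE; apply/existsP; exists u; rewrite ovu connect0.
Qed.

End Orientations.

(** * Degree sums and edge counts *)

Section EdgeCounts.
Local Open Scope nat_scope.
Variable T : finType.
Implicit Types (e : rel T) (W : {set T}) (G : sgraph T).

Definition degree_in e W (x : T) : nat := \sum_(y in W) e x y.

(** For symmetric irreflexive [e], this is twice the number of edges inside [W]. *)
Definition degree_sum e W : nat := \sum_(x in W) degree_in e W x.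

Lemma degree_inE e W x : degree_in e W x = #|[set y in W | e x y]|.
Proof.
rewrite /degree_in -sum1dep_card big_mkcondr /=.
by apply: eq_bigr => y _; case: (e x y).
Qed.

Lemma outdegE e x : outdeg e x = \sum_y e x y.
Proof.
rewrite /outdeg -sum1dep_card big_mkcond /=.
by apply: eq_bigr => y _; case: (e x y).
Qed.

Lemma degree_sum_D1 e W v : symmetric e -> irreflexive e -> v \in W ->
  degree_sum e W = degree_sum e (W :\ v) + 2 * degree_in e W v.
Proof.
move=> e_sym e_irr vW; rewrite /degree_sum (big_setD1 v) //=.
under eq_bigr => x _ do rewrite /degree_in (big_setD1 v) //=.
rewrite big_split /= mul2n -addnn addnC [RHS]addnA [X in _ = X + _]addnC.
congr (_ + _ + _); rewrite /degree_in (big_setD1 v vW) /= e_irr add0n.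
by apply: eq_bigr => x _; rewrite e_sym.
Qed.

Lemma degree_sum_subset e W W' : W' \subset W ->
  degree_sum e W' <= degree_sum e W.
Proof.
move=> sub; rewrite /degree_sum [leqRHS](big_setID W') /= (setIidPr sub).
apply: leq_trans (leq_addr _ _); apply: leq_sum => x _.
rewrite /degree_in [leqRHS](big_setID W') /= (setIidPr sub).
exact: leq_addr.
Qed.

(** Ordered adjacent pairs are grouped by their edge; each fibre holds at most the two orderings of
    its ends. *)
Lemma handshake_le G : \sum_x deg G x <= 2 * nedges G.
Proof.
under eq_bigr => x _ do rewrite -[deg G x]/(outdeg (adj G) x) outdegE.
rewrite pair_big /=.
pose f (p : T * T) := [set p.1; p.2].
have -> : \sum_p adj G p.1 p.2 = \sum_(p | adj G p.1 p.2) 1.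
  by rewrite [RHS]big_mkcond; apply: eq_bigr => p _; case: (adj G p.1 p.2).
rewrite (partition_big f (mem (edges G))) /=; last first.
  move=> [x y] /= xy; apply/imset2P; exists x y => //; first exact: adj_vset xy.
  by rewrite inE xy (@adj_vset _ G y x) // adj_sym.
rewrite mulnC -sum_nat_const; apply: leq_sum => _ /imset2P[x y _ _ ->].
rewrite sum1dep_card.
apply: leq_trans (_ : #|[set (x, y); (y, x)]| <= 2); last by rewrite cards2; case: eqP.
apply/subset_leq_card/subsetP => -[u v]; rewrite !inE /= => /andP[uv /eqP Euv].
have: u \in f (u, v) by rewrite !inE eqxx.
have: v \in f (u, v) by rewrite !inE eqxx orbT.
rewrite Euv !inE => /orP[] /eqP Ev /orP[] /eqP Eu; rewrite Eu Ev ?eqxx ?orbT //;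
  by move: uv; rewrite Eu Ev adj_irr.
Qed.

End EdgeCounts.

(** * Degree bound for independent sets in list-critical graphs *)

Section ListCritical.
Local Open Scope nat_scope.
Variables (T : finType) (G : sgraph T) (k : nat).
Hypotheses (k_gt1 : 1 < k) (crit : list_critical k G).

(** Criticality colours the proper subgraph induced on [R]. Deleting the colours used there costs
    the list of [v] at most one colour per neighbour in [R], which is the loss allowed for [L']. *)
Lemma list_critical_extension (R : {set T}) (L : T -> {fset nat}) :
  vset G :\: R != set0 ->
  (forall v, v \in vset G -> k - 1 <= #|` L v|) ->
  (forall L' : T -> {fset nat},
     {in vset G :\: R, forall v,
        k - 1 <= #|` L' v| + #|[set u in R | adj G v u]|} ->
     exists c : T -> nat,
       {in vset G :\: R, forall v, c v \in L' v} /\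
       {in vset G :\: R &, forall x y, adj G x y -> c x != c y}) ->
  exists c : T -> nat,
    (forall v, v \in vset G -> c v \in L v) /\
    (forall x y, adj G x y -> c x != c y).
Proof.
move=> /set0Pn[z /setDP[zG zR]] leL ext.
have properR : proper_subgraph (induced G R) G.
  split; first by split; [exact: subsetIl | move=> x y /and3P[]].
  by case=> /subsetP/(_ z zG); rewrite inE (negbTE zR) andbF.
have [|c0 [c0L c0_proper]] := crit.2 _ properR L.
  by move=> v /setIP[vG _]; apply: leL.
pose used v := [fset c0 u | u in [set u in R | adj G v u]]%fset.
have [v /setDP[vG _]|c1 [c1L c1_proper]] := ext (fun v => L v `\` used v)%fset.
  have: #|` used v| <= #|[set u in R | adj G v u]|.
    by rewrite (leq_trans (leq_imfset_card _ _ _)) // -cardE.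
  have: #|` (L v `&` used v)%fset| <= #|` used v|.
    by rewrite fsubset_leq_card // fsubsetIr.
  by have := leL v vG; rewrite cardfsD; lia.
exists (fun x => if x \in R then c0 x else c1 x); split.
  move=> v vG; case: ifPn => vR; first by rewrite c0L // inE vG.
  by have := c1L v; rewrite !inE vR vG => /(_ isT) /andP[].
have cross x y : adj G x y -> x \notin R -> y \in R -> c1 x != c0 y.
  move=> xy xR yR; have xG := adj_vset xy.
  have := c1L x; rewrite !inE xR xG => /(_ isT) /andP[+ _].
  by apply: contraNneq => ->; apply: in_imfset; rewrite /= inE yR xy.
move=> x y xy; have xG := adj_vset xy.
have yG : y \in vset G by apply: (@adj_vset _ G y x); rewrite adj_sym.
case: ifPn => xR; case: ifPn => yR.
- by apply: c0_proper; rewrite /= /induced_adj xR yR.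
- by rewrite eq_sym cross // adj_sym.
- exact: cross.
- by apply: c1_proper; rewrite // inE ?xR ?yR.
Qed.

(* Edges outside [A] are bidirected and the edges at [A] are oriented so that
   out-degrees exceed [k - 2] only on a set [R] that no arc leaves; then
   [vset G :\: R] could be coloured last, so [R] is everything. *)
Lemma independent_degree_bound (A : {set T}) :
  {in A &, forall x y, ~~ adj G x y} ->
  \sum_(x in A) deg G x + (k - 2) * nverts G + 1 <= 2 * nedges G.
Proof.
move=> indA.
pose e x y := adj G x y && ((x \in A) || (y \in A)).
pose b x y := adj G x y && ((x \notin A) && (y \notin A)).
have e_sym : symmetric e by move=> x y; rewrite /e adj_sym orbC.
have e_irr : irreflexive e by move=> x; rewrite /e adj_irr.
have [d [R [od Rclosed Rout Rin Rover]]] :=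
  orientation_closed_set (fun x => outdeg b x) (k - 2) e_sym e_irr.
have d_e x y : d x y -> e x y.
  by move=> dxy; have := od x y; rewrite dxy; case: (e x y).
pose D x y := d x y || b x y.
have loadD x : load (fun x => outdeg b x) d x = outdeg D x.
  rewrite /load /outdeg -cardsUI [X in _ + X](_ : _ = 0) ?addn0.
    by apply: eq_card => y; rewrite !inE.
  apply: eq_card0 => y; rewrite !inE; apply/negP => /andP[/d_e/andP[_ xyA]].
  by rewrite /b -negb_or xyA andbF.
case: (set_0Vmem (vset G :\: R)) => [/eqP|[z zF]]; last first.
  case: crit.1 => L leL; apply: (list_critical_extension (R := R)) => //.
    by apply/set0Pn; exists z.
  move=> L' leL'.
  have D_irr : irreflexive D.
    move=> x; rewrite /D /b adj_irr orbF; apply/negP => /d_e.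
    by rewrite /e adj_irr.
  have [S||c [cL' c_proper]] :=
    @kernel_perfect_coloring _ D (vset G :\: R) L'.
  - apply: (kernel_exists D_irr (A := A)) => x y xA yA.
      rewrite /D /b xA andbF orbF; apply/negP => /d_e/andP[].
      by rewrite (negbTE (indA x y xA yA)).
    have ndA u v : u \in ~: A -> v \in ~: A -> d u v = false.
      rewrite !inE => uA vA; apply/negP => /d_e/andP[_].
      by rewrite (negbTE uA) (negbTE vA).
    by rewrite /D !ndA // /b adj_sym [(x \notin A) && _]andbC.
  - move=> v vF; have /setDP[vG vR] := vF.
    have := leL' v vF; have := Rout v vR; rewrite loadD.
    (* Every neighbour of [v] in [R] is an out-neighbour: the edge is bidirected, or it is oriented
       into [R] because no arc leaves [R]. So what the list loses to [R] is matched by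
       out-degree. *)
    suff: #|[set y in vset G :\: R | D v y]| + #|[set u in R | adj G v u]|
            <= outdeg D v by lia.
    rewrite -cardsUI [X in _ + X](_ : _ = 0) ?addn0; last first.
      by apply: eq_card0 => y; rewrite !inE; case: (y \in R); rewrite ?andbF.
    apply/subset_leq_card/subsetP => u; rewrite !inE.
    case/orP => [/andP[_ ->] //|/andP[uR vu]].
    rewrite /D; case: (boolP (e v u)) => [evu|].
      have := od v u; rewrite evu; case: (d v u) => //.
      by case duv: (d u v) => // _; rewrite (Rclosed u v uR duv) in vR.
    by rewrite /e /b vu /= negb_or => ->; rewrite orbT.
  exists c; split=> // x y xF yF xy.
  case Dxy: (D x y); first exact: c_proper.
  rewrite eq_sym; apply: c_proper => //; move: Dxy; rewrite /D /b (adj_sym G y x) xy /=.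
  have := od x y; rewrite /e xy /=.
  case: (x \in A); case: (y \in A); case: (d x y); case: (d y x) => //.
(* Now [R] contains every vertex of [G]. An empty [R] would make [G] empty, hence choosable. *)
rewrite setD_eq0 => GR; have [R0|Rn0] := eqVneq R set0.
  case: crit.1 => L _; exists (fun=> 0).
  have G0 x : x \notin vset G by apply/negP => /(subsetP GR); rewrite R0 inE.
  by split=> [v|x y /adj_vset]; rewrite (negbTE (G0 _)).
have [x xR ovx] := Rover Rn0.
have two_d : 2 * \sum_x outdeg d x = \sum_x \sum_y e x y.
  under eq_bigr => u _ do rewrite outdegE.
  rewrite mul2n -addnn [X in _ + X = _]exchange_big -big_split; apply: eq_bigr => u _.
  by rewrite -big_split; apply: eq_bigr => v _; apply: od.
(* By independence each edge at [A] has exactly one end in [A]. *)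
have sum_e : \sum_x \sum_y e x y = 2 * \sum_(x in A) deg G x.
  pose a u v : nat := (u \in A) && adj G u v.
  have -> : \sum_(x in A) deg G x = \sum_x \sum_y a x y.
    rewrite big_mkcond; apply: eq_bigr => u _.
    rewrite /a -[deg G u]/(outdeg _ u) outdegE.
    by case: (u \in A) => //; rewrite big1.
  rewrite mul2n -addnn [X in _ = _ + X]exchange_big -big_split; apply: eq_bigr => u _.
  rewrite -big_split; apply: eq_bigr => v _; rewrite /a /e (adj_sym G v u).
  have := indA u v; case: (u \in A); case: (v \in A); case: (adj G u v) => //.
  by move=> /(_ isT isT).
have sum_deg : \sum_x deg G x = \sum_x outdeg b x + \sum_x \sum_y e x y.
  rewrite -big_split; apply: eq_bigr => u _ /=.
  rewrite -[deg G u]/(outdeg _ u) !outdegE -big_split; apply: eq_bigr => v _.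
  by rewrite /b /e -negb_or; case: (adj G u v) => //; case: (_ || _).
(* All loads on [vset G] are at least [k - 2], and the overloaded vertex [x] supplies the extra 1 of
   the bound. It lies in [G] because vertices outside have load 0. *)
have sum_load : (k - 2) * nverts G < \sum_x load (fun x => outdeg b x) d x.
  have xG : x \in vset G.
    apply: contraTT ovx => xG; rewrite -leqNgt loadD.
    rewrite (_ : outdeg D x = 0) // /outdeg; apply: eq_card0 => y; rewrite !inE.
    apply/negP => /orP[/d_e|] /andP[/adj_vset]; by rewrite (negbTE xG).
  rewrite mulnC -sum_nat_const.
  apply: leq_trans (_ : _ <= \sum_(u in vset G) load (fun x => outdeg b x) d u) _.
    rewrite (bigD1 x xG) [leqRHS](bigD1 x xG) /= -addSn leq_add //.
    by apply: leq_sum => u /andP[uG _]; apply: Rin (subsetP GR u uG).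
  by rewrite [leqRHS](bigID (mem (vset G))) /= leq_addr.
have := handshake_le G; rewrite sum_deg sum_e; move: sum_load.
by rewrite /load big_split /=; lia.
Qed.

End ListCritical.

(** * Weighted bound for independent sets *)

(* Vertices of degree at least two are discarded; what remains is a matching
   plus isolated vertices, where a greedy choice is optimal. *)
Lemma independent_weight_bound (R : realFieldType) (T : finType) (e : rel T)
    (a t : R) (W : {set T}) :
  symmetric e -> irreflexive e -> a <= 6 * t -> 2 * t <= a -> 0 <= t ->
  exists I : {set T},
    [/\ I \subset W, {in I &, forall x y, ~~ e x y}
      & (a / 2 + t) * #|W|%:R - t * (degree_sum e W)%:R <= a * #|I|%:R].
Proof.
move=> e_sym e_irr a_le6t le2t_a t_ge0.
have [n] := ubnP #|W|; elim: n W => // n IHn W leWn.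
have [W0|[v0 v0W]] := set_0Vmem W.
  exists set0; split; rewrite ?sub0set //; first by move=> x y; rewrite inE.
  by rewrite W0 cards0 !mulr0 add0r oppr_le0 mulr_ge0.
have ltW v : v \in W -> (#|W :\ v| < n)%N.
  by move=> vW; move: leWn; rewrite (cardsD1 v W) vW.
(* Dropping a vertex of degree at least 2 does not decrease the left side: it removes [a / 2 + t]
   but restores at least [4 * t], and [a <= 6 * t]. *)
case: (boolP [exists v in W, 1 < degree_in e W v]%N).
  case/exists_inP => v vW deg_v; have [I [IW indI boundI]] := IHn _ (ltW v vW).
  exists I; split=> //; first exact: subset_trans IW (subsetDl _ _).
  rewrite (cardsD1 v W) vW (degree_sum_D1 e_sym e_irr vW) 2!natrD natrM /= mulr1n.
  have : (2 : R) <= (degree_in e W v)%:R by rewrite ler_nat.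
  move: boundI; move: (#|W :\ v|%:R) (#|I|%:R) (degree_in e W v)%:R (degree_sum _ _)%:R.
  by move=> w i g s; nra.
rewrite negb_exists_in => /forall_inP /(_ v0 v0W); rewrite -leqNgt => deg_v0.
(* Deleting [v0] and its neighbours costs at most [a], which [v0] pays for: an isolated [v0] costs
   [a / 2 + t <= a], and with one neighbour the cost is at most [2 * (a / 2 + t) - 2 * t = a]. *)
pose W' := [set y in W :\ v0 | ~~ e v0 y].
have W'W : W' \subset W :\ v0 by apply/subsetP => x; rewrite inE => /andP[].
have [I [IW' indI boundI]] := IHn W' (leq_ltn_trans (subset_leq_card W'W) (ltW _ v0W)).
have I_v0 y : y \in I -> [/\ y \in W, y != v0 & ~~ e v0 y].
  by move/(subsetP IW'); rewrite !inE => /andP[/andP[-> ->] ->].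
exists (v0 |: I); split.
- by apply/subsetP => x /setU1P[->//|/I_v0[]].
- move=> x y /setU1P[->|xI] /setU1P[->|yI]; rewrite ?e_irr //.
  + by case: (I_v0 y yI).
  + by rewrite e_sym; case: (I_v0 x xI).
  + exact: indI.
have v0I : v0 \notin I by apply/negP => /I_v0[]; rewrite eqxx.
have cardW : (#|W| = #|W'| + 1 + degree_in e W v0)%N.
  rewrite (cardsD1 v0) v0W degree_inE -(cardsID [set y | e v0 y] (W :\ v0)).
  have -> : (W :\ v0) :&: [set y | e v0 y] = [set y in W | e v0 y].
    by apply/setP => y; rewrite !inE; case: eqVneq => [->|]; rewrite ?e_irr ?andbF.
  have -> : (W :\ v0) :\: [set y | e v0 y] = W'.
    by apply/setP => y; rewrite !inE andbC.
  by rewrite addnC addnAC [(#|W'| + _ + _)%N]addnAC addnC addnA.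
have sumW : (degree_sum e W' + 2 * degree_in e W v0 <= degree_sum e W)%N.
  by rewrite (degree_sum_D1 e_sym e_irr v0W) leq_add2r degree_sum_subset.
rewrite cardsU1 v0I cardW.
move: sumW; rewrite -(ler_nat R) natrD natrM !natrD /= !mulr1n.
move: deg_v0 boundI; rewrite -(ler_nat R) /=.
move: (#|W'|%:R) (#|I|%:R) (degree_in e W v0)%:R.
move: (degree_sum _ _)%:R (degree_sum _ _)%:R.
by move=> s s' w i g; nra.
Qed.

(** * The bound on [beta] *)

Theorem lemma1p2 (R : realType) (T : finType) (G : sgraph T) (k : nat)
    (lambda : R) :
  list_critical k G ->
  2 <= lambda <= 6 * (k%:R - 1) / k%:R ->
  (beta k (low_subgraph k G))%:R <=
    2 / lambda * (nedges (high_subgraph k G))%:R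
    + (2 * (nedges G)%:R - (k%:R - 2) * (nverts G)%:R
       - (k%:R / 2 + (k%:R - 1) / lambda) * (nverts (high_subgraph k G))%:R - 1)
      / (k%:R - 1).
Proof.
move=> crit /andP[lambda_ge2 lambda_le].
(* For [k = 0] (division by zero gives 0) and for [k = 1] the upper bound on [lambda] is 0,
   contradicting [2 <= lambda]. *)
have k_gt1 : (1 < k)%N.
  case: k lambda_le {crit} => [|[|k]] // lambda_le; exfalso.
    by move: lambda_le; rewrite invr0 mulr0; lra.
  by move: lambda_le; rewrite subrr mulr0 mul0r; lra.
have k_ge2 : (2 : R) <= k%:R by rewrite ler_nat.
have lambda_gt0 : 0 < lambda by lra.
pose t := (k%:R - 1) / lambda.
have t_lambda : t * lambda = k%:R - 1 by rewrite divfK ?gt_eqF.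
have t_ge0 : 0 <= t by rewrite divr_ge0; lra.
have k_le6t : k%:R <= 6 * t.
  rewrite /t mulrA ler_pdivlMr //.
  by move: lambda_le; rewrite ler_pdivlMr; lra.
have le2t_k : 2 * t <= k%:R by nra.
pose H := [set v in vset G | (k <= deg G v)%N].
have [I [IH indI boundI]] :=
  independent_weight_bound H (adj_sym G) (adj_irr G) k_le6t le2t_k t_ge0.
have vsetH : vset (high_subgraph k G) = H.
  by apply/setP => x; rewrite !inE; case: (x \in vset G).
have sumH : (degree_sum (adj G) H <= 2 * nedges (high_subgraph k G))%N.
  apply: leq_trans (handshake_le _); rewrite /degree_sum big_mkcond.
  apply: leq_sum => x _; case: ifP => // xH.
  rewrite degree_inE; apply/subset_leq_card/subsetP => y; rewrite !inE.
  by rewrite /= /induced_adj xH !inE.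
have [S [S_low indS cardS]] : exists S : {set T},
    [/\ {in S, forall v, deg G v = (k - 1)%N /\
                          forall u, u \in H -> ~~ adj G v u},
        {in S &, forall x y, ~~ adj G x y}
      & beta k (low_subgraph k G) = #|S|].
  rewrite /beta /indep_number; set X := induced _ _.
  have [|S XS ->] := @eq_bigmax_cond _ (independent X) (fun A : {set T} => #|A|).
    apply/card_gt0P; exists set0; rewrite unfold_in sub0set.
    by apply/forall_inP => x; rewrite inE.
  case/andP: XS => /subsetP SX /forall_inP indS.
  have S_low v : v \in S -> [/\ v \in vset G, deg G v = (k - 1)%N
                             & deg (low_subgraph k G) v = (k - 1)%N].
    by move/SX; rewrite !inE => /andP[/and3P[-> _ /eqP->] /andP[_ /eqP->]].
  exists S; split=> //.
    move=> v vS; have [vG deg_v deg_low_v] := S_low v vS; split=> // u uH.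
    apply/negP => vu.
    (* A neighbour [u] in [H] would be lost in the low subgraph, yet [v] has degree [k - 1] in both
       graphs. *)
    have: [set x | adj (low_subgraph k G) v x] \proper [set x | adj G v x].
      apply/properP; split; first by apply/subsetP => x; rewrite !inE => /and3P[].
      exists u; rewrite !inE //= /induced_adj !inE.
      move: uH; rewrite inE => /andP[_ deg_u].
      by apply/negP => /and3P[_ /andP[_ /eqP]]; lia.
    by move/proper_card; rewrite -!/(deg _ v) deg_v deg_low_v ltnn.
  move=> x y xS yS; have /forall_inP/(_ y yS) := indS x xS.
  apply: contra => xy.
  have [xG dx dlx] := S_low x xS; have [yG dy dly] := S_low y yS.
  rewrite /= /induced_adj !inE xG yG dx dy dlx dly !eqxx /=.
  by rewrite /induced_adj !inE xG yG dx dy !eqxx xy.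
have SI0 : [disjoint S & I].
  apply/pred0P => x /=; apply/negP => /andP[xS xI].
  have [deg_x _] := S_low x xS; move: (subsetP IH x xI); rewrite inE => /andP[_]; lia.
have indSI : {in S :|: I &, forall x y, ~~ adj G x y}.
  move=> x y /setUP[xS|xI] /setUP[yS|yI].
  - exact: indS.
  - by have [_ ->] := S_low x xS; rewrite // (subsetP IH).
  - by rewrite adj_sym; have [_ ->] := S_low y yS; rewrite // (subsetP IH).
  - exact: indI.
have degSI : ((k - 1) * #|S| + k * #|I| <= \sum_(x in S :|: I) deg G x)%N.
  rewrite (eq_bigl [predU S & I]); last by move=> x; rewrite !inE.
  rewrite bigU //= mulnC -sum_nat_const mulnC -sum_nat_const leq_add //.
    by apply: leq_sum => x xS; have [->] := S_low x xS.
  by apply: leq_sum => x /(subsetP IH); rewrite inE => /andP[].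
have := independent_degree_bound k_gt1 crit indSI.
move/(leq_trans _) => /(_ _ (leq_add (leq_add degSI (leqnn _)) (leqnn _))).
move: sumH; rewrite -!(ler_nat R) !natrD !natrM !natrB ?(ltnW k_gt1) // => sumH main.
rewrite cardS /nverts vsetH -/t.
have k1_gt0 : 0 < (k%:R - 1 : R) by lra.
(* Over the common denominator [k - 1], the goal is [main] with [k|I|] replaced by its lower bound,
   using [sumH]. *)
have -> : 2 / lambda = 2 * t / (k%:R - 1).
  by rewrite /t; field; rewrite !gt_eqF.
rewrite mulrAC -mulrDl ler_pdivlMr //.
move: main sumH boundI; rewrite /nverts.
move: (#|S|%:R) (#|I|%:R) (#|H|%:R) (#|vset G|%:R).
move: (degree_sum _ _)%:R (nedges _)%:R (nedges _)%:R.
by move=> g eH eG s i h n; nra.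
Qed.
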